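(* Let $\mathbf{A}\in\mathbb{R}^{d\times d}$ be an invertible matrix with $A_{ii}\neq 0$ for all $i$. Define the matrix $\widetilde{|\mathbf{R}|}\in\mathbb{R}^{d\times d}$ by $\widetilde{|R|}_{ij}=(1-\delta_{ij})\frac{|A_{ij}|}{|A_{ii}|}$. If the spectral radius satisfies $\rho(\widetilde{|\mathbf{R}|})<1$, then for every $\mathbf{b}\in\mathbb{R}^d$ the GaBP algorithm for the system $\mathbf{A}\mathbf{x}=\mathbf{b}$ (defined in the context) converges to the solution, i.e. its iterates $\mathbf{x}$ after $n$ sweeps converge to $\mathbf{x}^{\star}=\mathbf{A}^{-1}\mathbf{b}$ as $n\to\infty$.
   Context: The matrix $\mathbf{A}$ is not assumed symmetric. Its directed graph has vertex set $\mathcal{V}=\{1,\dots,d\}$ and, for $i\ne j$, a directed edge $(j,i)\in\mathcal{E}$ from $j$ to $i$ if and only if $A_{ij}\neq 0$. $N(j)$ is the set of $k\neq j$ with $(k,j)\in\mathcal{E}$. Each edge $(j,i)\in\mathcal{E}$ carries two real messages $\widetilde{\Lambda}_{ji}$ and $m_{ji}$, initialised at $0$; messages attached to pairs that are not edges are by convention $0$. GaBP algorithm (for a nonsymmetric linear system). Repeat sweeps (without stopping, for the purpose of convergence); in each sweep, for each $j\in\mathcal{V}$ in a fixed order, using the current values of the messages (updates are made in place): 1. $m:=b_j+\sum_{k\in N(j)}m_{kj}$ and $\Sigma:=A_{jj}+\sum_{k\in N(j)}\widetilde{\Lambda}_{kj}A_{kj}$; 2. $x_j\leftarrow m/\Sigma$;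 3. for each $i$ with $(j,i)\in\mathcal{E}$: $\widetilde{\Lambda}_{ji}\leftarrow -A_{ij}/(\Sigma-\widetilde{\Lambda}_{ij}A_{ij})$, and then $m_{ji}\leftarrow\widetilde{\Lambda}_{ji}\,(m-m_{ij})$. *)

(* Defs.v *)
From HB Require Import structures.
From mathcomp Require Import all_boot all_order all_algebra.
From mathcomp Require Import all_classical all_reals all_analysis.
From mathcomp Require Import complex.

Set Implicit Arguments.
Unset Strict Implicit.
Unset Printing Implicit Defensive.

Import Order.TTheory GRing.Theory Num.Theory.
Import numFieldNormedType.Exports.

Local Open Scope classical_set_scope.
Local Open Scope ring_scope.

(* The spectrum is taken over the complex numbers R[i].  MathComp's
   [eigenvalue] uses row eigenvectors; these have the same eigenvalues as
   column eigenvectors.  In dimension 0 the spectrum is empty and the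
   supremum is 0. *)
Definition spectral_radius (R : realType) (d : nat) (M : 'M[R]_d) : R :=
  sup [set ComplexField.Normc.normc l | l in
         [set l : R[i] | eigenvalue (map_mx (real_complex R) M) l]].

Definition abs_scaled_offdiag (R : realType) (d : nat) (A : 'M[R]_d) :
    'M[R]_d :=
  \matrix_(i, j) ((1 - (i == j)%:R) * (`|A i j| / `|A i i|)).

(* [gabp_edge A j i]: there is an edge from j to i. *)
Definition gabp_edge (R : realType) (d : nat) (A : 'M[R]_d) (j i : 'I_d) :
    bool :=
  (i != j) && (A i j != 0).

(* [gabp_Lambda st j i] and [gabp_msg st j i] are the messages sent from j to
   i; they are never modified, hence stay 0, when (j, i) is not an edge. *)
Record gabp_state (R : realType) (d : nat) : Type := GabpState {
  gabp_x : 'cV[R]_d;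
  gabp_Lambda : 'M[R]_d;
  gabp_msg : 'M[R]_d
}.

(* The initial value of x is never read. *)
Definition gabp_init (R : realType) (d : nat) : gabp_state R d :=
  GabpState 0 0 0.

(* The visit of node j.  The result is [None] when one of the divisions to be
   performed is by zero.  The updates for the various targets i can be written
   simultaneously because the update for i reads only m, Sigma and the messages
   from i to j, none of which is changed by the updates for other targets. *)
Definition gabp_visit (R : realType) (d : nat) (A : 'M[R]_d) (b : 'cV[R]_d)
    (st : gabp_state R d) (j : 'I_d) : option (gabp_state R d) :=
  let: GabpState x L mu := st in
  let m := b j 0 + \sum_(k | gabp_edge A k j) mu k j in
  let Sigma := A j j + \sum_(k | gabp_edge A k j) L k j * A k j in
  let den i := Sigma - L i j * A i j in
  let newL i := - A i j / den i in
  if (Sigma != 0) && [forall i, gabp_edge A j i ==> (den i != 0)] then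
    Some (GabpState
      (\col_k (if k == j then m / Sigma else x k 0))
      (\matrix_(k, i) (if (k == j) && gabp_edge A j i
                       then newL i else L k i))
      (\matrix_(k, i) (if (k == j) && gabp_edge A j i
                       then newL i * (m - mu i j) else mu k i)))
  else None.

Definition gabp_sweep (R : realType) (d : nat) (A : 'M[R]_d) (b : 'cV[R]_d)
    (order : seq 'I_d) (st : gabp_state R d) : option (gabp_state R d) :=
  foldl (fun ost j => obind (fun st' => gabp_visit A b st' j) ost)
    (Some st) order.

Definition gabp (R : realType) (d : nat) (A : 'M[R]_d) (b : 'cV[R]_d)
    (order : seq 'I_d) (n : nat) : option (gabp_state R d) :=
  iter n (obind (gabp_sweep A b order)) (Some (gabp_init R d)).

(* The run never divides by zero, and its iterates converge to [l]. *)
Definition gabp_converges_to (R : realType) (d : nat) (A : 'M[R]_d)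
    (b : 'cV[R]_d) (order : seq 'I_d) (l : 'cV[R]_d) : Prop :=
  exists x : nat -> 'cV[R]_d,
    (forall n, omap (@gabp_x R d) (gabp A b order n) = Some (x n)) /\
    (x @ \oo --> l).

(* Main.v *)
Require Import Defs.
From mathcomp Require Import all_boot all_order all_algebra.
From mathcomp Require Import ring lra complex.
From mathcomp Require Import all_classical all_reals all_analysis.

Set Implicit Arguments.
Unset Strict Implicit.
Unset Printing Implicit Defensive.

Import Order.TTheory GRing.Theory Num.Theory.
Import numFieldNormedType.Exports.
Local Open Scope classical_set_scope.
Local Open Scope ring_scope.

(** The run of GaBP on A is dominated, entry by entry and increment by
    increment, by the run of GaBP on a comparison system in which all messages
    are nonnegative and grow.

    Since the spectral radius is below 1, A becomes strictly row diagonally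
    dominant after a rescaling of the columns: there are weights w > 0 with
    |A_jj| w_j = c_j + sum_(k != j) |A_jk| w_k, for a prescribed c > 0
    ([dominance_weights]); take c >= |b|.  The comparison matrix has diagonal
    |A_jj| and off-diagonal entries -|A_ij|, so w solves its system with
    right-hand side c.  GaBP on that system, started at 0, has messages
    Lambda, m >= 0 that satisfy m_kj + Lambda_kj |A_kj| w_j <= |A_jk| w_k
    ([admissible]): with x_j frozen at w_j, eliminating the branch behind k
    gives x_k at most w_k.  This single invariant bounds all messages and keeps
    all pivots away from 0 ([admissible_update], [admissible_pivot_gt0]).

    The update formulas are built from sums, products and inverses of pivots,
    and these operations preserve the relation
    |u| <= v, |u' - u| <= v' - v between a step u -> u' and a step v -> v'
    ([majorized], [update_majorized]).  Hence each visit changes the state for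
    A by at most as much as it increases the state for the comparison system
    ([run_invariant]).  The latter is monotone and bounded, so both converge
    ([majorized_cvgn]), and no division by zero occurs ([gabp_visitE]).

    Every vertex is visited infinitely often, so the limit state satisfies all
    message equations ([run_stationary_limit]).  For such a state put
    E_ji = m_ji - Lambda_ji A_ji x_i + A_ij x_j.  The equations give
    E_ji = - Lambda_ji E_ij for each edge, hence
    (1 - Lambda_ji Lambda_ij) E_ji = 0, where the factor is nonzero because the
    pivots are.  So E = 0, and the equation that defines x_j turns into
    row j of A x = b ([stationary_solution]). *)

(** * Diagonal dominance from the spectral radius *)

(** The supremum that defines the spectral radius is a true upper bound because
    the eigenvalues are among the finitely many roots of the characteristic
    polynomial. *)
Lemma eigenvalue_le_spectral_radius (R : realType) (d : nat) (M : 'M[R]_d)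
    (a : R) :
  eigenvalue M a -> `|a| <= spectral_radius M.
Proof.
move=> Ma; apply: ub_le_sup; last first.
  exists (real_complex R a); first by rewrite /= eigenvalue_map.
  by rewrite /= expr0n addr0 sqrtr_sqr.
have [rs p_rs] := closed_field_poly_normal
  (char_poly (map_mx (real_complex R) M)).
exists (\sum_(z <- rs) ComplexField.Normc.normc z) => _ [l /= Ml <-].
have l_rs : l \in rs.
  move: Ml; rewrite eigenvalue_root_char p_rs rootZ ?root_prod_XsubC //.
  by rewrite lead_coef_eq0 monic_neq0 ?char_poly_monic.
rewrite (big_rem l) //= lerDl sumr_ge0 // => -[x y] _.
exact: sqrtr_ge0.
Qed.

(** Consider w(t) = (1 - t M)^-1 e along t in [0, 1], where det (1 - t M) cannot
    vanish: 1/t would be an eigenvalue that is at least 1.  If w(t) >= 0, then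
    w(t) = e + t M w(t) >= e > 0; so w(t) > 0 is both an open and a closed
    condition on t, and it holds at t = 0.  By connectedness it holds at
    t = 1. *)
Lemma nonneg_resolvent_gt0 (R : realType) (d : nat) (M : 'M[R]_d)
    (e : 'cV[R]_d) :
  (forall i j, 0 <= M i j) -> spectral_radius M < 1 -> (forall i, 0 < e i 0) ->
  exists2 w : 'cV[R]_d, (forall i, 0 < w i 0) & w = e + M *m w.
Proof.
move=> M_ge0 rho_lt1 e_gt0.
(* The numerators q and the denominator D of w(t) are polynomials in t. *)
pose P : 'M[{poly R}]_d := 1%:M - 'X *: map_mx polyC M.
pose D := \det P.
pose q : 'cV[{poly R}]_d := \adj P *m map_mx polyC e.
have Pt t : map_mx (horner_eval t) P = 1%:M - t *: M.
  apply/matrixP=> i j; rewrite !mxE /horner_eval !hornerE.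
  by rewrite hornerMn hornerC.
have qE : q = D *: map_mx polyC e + 'X *: (map_mx polyC M *m q).
  have PE : P *m q = D *: map_mx polyC e.
    by rewrite /q mulmxA mul_mx_adj mul_scalar_mx.
  by rewrite -PE /P mulmxBl mul1mx -scalemxAl subrK.
have qtE t i : (q i 0).[t] =
    D.[t] * e i 0 + t * \sum_j M i j * (q j 0).[t].
  rewrite {1}qE !mxE !hornerE; congr (_ + _ * _).
  by rewrite horner_sum; apply: eq_bigr => j _; rewrite mxE hornerM hornerC.
have D_neq0 t : 0 <= t <= 1 -> D.[t] != 0.
  move=> /andP[t_ge0 t_le1]; apply/negP => /eqP Dt0.
  have : \det (1%:M - t *: M) == 0.
    by apply/eqP; rewrite -Pt det_map_mx; exact: Dt0.
  case/det0P => v v_neq0; rewrite mulmxBr mulmx1 -scalemxAr.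
  move=> /subr0_eq vE.
  have t_gt0 : 0 < t.
    rewrite lt_neqAle t_ge0 andbT; apply: contraNneq v_neq0 => t0.
    by rewrite vE -t0 scale0r.
  have /eigenvalue_le_spectral_radius : eigenvalue M t^-1.
    apply/eigenvalueP; exists v => //.
    by rewrite {2}vE scalerA mulVf ?scale1r // gt_eqF.
  apply/negP; rewrite -ltNge (lt_le_trans rho_lt1) //.
  by rewrite ger0_norm ?invr_ge0 // invf_ge1.
(* Both w(t) > 0 and w(t) >= e are stated for D and q, hence without inverses;
   on [0, 1] they agree. *)
pose B := [set t : R |
  t \in `[0, 1] /\ (0 < D.[t] /\ forall i, 0 < (q i 0).[t])].
have contp (p : {poly R}) (c : R) : open [set t : R | c < p.[t]].
  apply: (@open_comp _ _ (horner p) [set x : R | c < x]); last exact: open_gt.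
  by move=> x _; exact: continuous_horner.
have closedp (p : {poly R}) (c : R) : closed [set t : R | c <= p.[t]].
  apply: (@preimage_closed _ _ (horner p) [set x : R | c <= x]).
    by move=> x _; exact: continuous_horner.
  exact: closed_ge.
have B1 : B = `[0, 1]%classic.
  apply: segment_connected.
  - exists 0; split; first by rewrite in_itv /= lexx ler01.
    have D0 : D.[0] = 1.
      have := det_map_mx (horner_eval 0) P; rewrite Pt scale0r subr0 det1.
      by rewrite /horner_eval.
    by split=> [|i]; rewrite ?qtE D0 // mul0r addr0 mul1r.
  - exists [set t | 0 < D.[t] /\ forall i, 0 < (q i 0).[t]]; last by [].
    have -> : [set t | 0 < D.[t] /\ forall i, 0 < (q i 0).[t]] =
       [set t | 0 < D.[t]] `&` [set t | forall i, 0 < (q i 0).[t]] by [].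
    apply: openI; first exact: contp.
    rewrite openE => t h.
    have : \forall s \near t, forall i, 0 < (q i 0).[s].
      apply: (@filter_forall R 'I_d (fun i => [set s : R | 0 < (q i 0).[s]])
                (nbhs t) (nbhs_filter t)) => i.
      by apply: open_nbhs_nbhs; split; [exact: (contp (q i 0) 0) | exact: h].
    by [].
  - exists ([set t | 0 <= D.[t]] `&`
        \bigcap_i [set t | 0 <= (q i 0 - e i 0 *: D).[t]]).
      apply: closedI; first exact: (closedp D 0).
      by apply: closed_bigI => i _; exact: (closedp (q i 0 - e i 0 *: D) 0).
    apply/seteqP; split=> t /=.
      move=> [t01 [Dt qt]]; split=> //; split; first exact: ltW.
      move=> i _ /=; rewrite !hornerE qtE mulrC addrAC subrr add0r.
      rewrite mulr_ge0 //; first by move: t01; rewrite in_itv /= => /andP[].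
      by rewrite sumr_ge0 // => j _; rewrite mulr_ge0 // ltW.
    move=> [t01 [Dt qt]].
    have Dt0 : 0 < D.[t].
      by rewrite lt_neqAle Dt andbT eq_sym D_neq0 //; move: t01; rewrite in_itv.
    split=> //; split=> // i; have := qt i I; rewrite /= !hornerE subr_ge0.
    by apply: lt_le_trans; rewrite mulr_gt0.
have : B 1 by rewrite B1 /= in_itv /= lexx ler01.
move=> [_ [D1 q1]].
exists (\col_i ((q i 0).[1] / D.[1])) => [i|]; first by rewrite mxE divr_gt0.
apply/colP=> i; rewrite [LHS]mxE [RHS]mxE qtE mul1r mulrDl mulrAC.
rewrite mulfV ?gt_eqF // mul1r.
congr (_ + _); rewrite [RHS]mxE mulr_suml; apply: eq_bigr => j _.
by rewrite [in RHS]mxE mulrA.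
Qed.

(** Weighted strict diagonal dominance with prescribed slack c: multiply row j
    of w = e + M w by |A_jj|, for e_j = c_j / |A_jj|. *)
Lemma dominance_weights (R : realType) (d : nat) (A : 'M[R]_d) (c : 'I_d -> R) :
  (forall i, A i i != 0) -> spectral_radius (abs_scaled_offdiag A) < 1 ->
  (forall i, 0 < c i) ->
  exists2 w : 'I_d -> R, (forall i, 0 < w i) &
    forall j, `|A j j| * w j = c j + \sum_(k | k != j) `|A j k| * w k.
Proof.
move=> A_diag rho_lt1 c_gt0.
have nA_gt0 i : 0 < `|A i i| by rewrite normr_gt0.
case: (@nonneg_resolvent_gt0 _ _ (abs_scaled_offdiag A)
  (\col_i (c i / `|A i i|)) _ rho_lt1) => [i j|i|w w_gt0 wE].
- by rewrite mxE; case: eqP => _; rewrite ?subrr ?mul0r // subr0 mul1r divr_ge0.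
- by rewrite mxE divr_gt0.
exists (fun i => w i 0) => // j.
rewrite {1}wE !mxE mulrDr mulrCA mulfV ?gt_eqF // mulr1; congr (_ + _).
rewrite mulr_sumr [RHS]big_mkcond /=; apply: eq_bigr => k _.
rewrite mxE eq_sym; case: eqP => _ /=; first by rewrite subrr !mul0r mulr0.
by rewrite subr0 mul1r mulrA [X in X * _]mulrC divfK // gt_eqF.
Qed.

(** * Majorized increments *)

(** The step from u to u' is dominated by the step from v to v'.  It also forces
    |u'| <= v' and v <= v', see [majorized_norm] and [majorized_le]. *)
Definition majorized (R : realFieldType) (u u' v v' : R) : Prop :=
  `|u| <= v /\ `|u' - u| <= v' - v.

Lemma majorized_refl (R : realFieldType) (u v : R) :
  `|u| <= v -> majorized u u v v.
Proof. by move=> uv; split=> //; rewrite !subrr normr0. Qed.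

Lemma majorized_norm (R : realFieldType) (u u' v v' : R) :
  majorized u u' v v' -> `|u'| <= v'.
Proof.
move=> [h1 h2]; rewrite -[u'](subrK u) (le_trans (ler_normD _ _)) //.
by rewrite -[leRHS](subrK v) lerD.
Qed.

Lemma majorized_le (R : realFieldType) (u u' v v' : R) :
  majorized u u' v v' -> v <= v'.
Proof. by move=> [_ h]; rewrite -subr_ge0 (le_trans _ h). Qed.

Lemma majorized_trans (R : realFieldType) (u u' u'' v v' v'' : R) :
  majorized u u' v v' -> majorized u' u'' v' v'' -> majorized u u'' v v''.
Proof.
move=> [h1 h2] [_ h3]; split=> //.
rewrite -[u''](subrK u') -addrA (le_trans (ler_normD _ _)) //.
by rewrite -[v''](subrK v') -addrA lerD.
Qed.

Lemma majorizedD (R : realFieldType) (u u' v v' x x' y y' : R) :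
  majorized u u' v v' -> majorized x x' y y' ->
  majorized (u + x) (u' + x') (v + y) (v' + y').
Proof.
move=> [h1 h2] [h3 h4]; split.
  by rewrite (le_trans (ler_normD _ _)) ?lerD.
rewrite !opprD addrACA [leRHS]addrACA.
by rewrite (le_trans (ler_normD _ _)) ?lerD.
Qed.

Lemma majorized_sum (R : realFieldType) (I : finType) (P : pred I)
    (u u' v v' : I -> R) :
  (forall i, P i -> majorized (u i) (u' i) (v i) (v' i)) ->
  majorized (\sum_(i | P i) u i) (\sum_(i | P i) u' i)
            (\sum_(i | P i) v i) (\sum_(i | P i) v' i).
Proof.
move=> h; split.
  rewrite (le_trans (ler_norm_sum _ _ _)) //.
  by apply: ler_sum => i /h[].
rewrite -!sumrB (le_trans (ler_norm_sum _ _ _)) //.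
by apply: ler_sum => i /h[].
Qed.

Lemma majorizedM (R : realFieldType) (u u' v v' x x' y y' : R) :
  majorized u u' v v' -> majorized x x' y y' ->
  majorized (u * x) (u' * x') (v * y) (v' * y').
Proof.
move=> uv xy; have [h1 h2] := uv; have [h3 h4] := xy.
split; first by rewrite normrM ler_pM.
have -> : u' * x' - u * x = (u' - u) * x' + u * (x' - x) by ring.
have -> : v' * y' - v * y = (v' - v) * y' + v * (y' - y) by ring.
rewrite (le_trans (ler_normD _ _)) // !normrM lerD // ler_pM //.
exact: majorized_norm xy.
Qed.

(** The increment of an inverse is the increment of its argument divided by both
    arguments, and |a + u| >= |a| - v bounds these from below. *)
Lemma majorized_inv (R : realFieldType) (a u u' v v' : R) :
  majorized u u' v v' -> v < `|a| -> v' < `|a| ->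
  majorized (a + u)^-1 (a + u')^-1 (`|a| - v)^-1 (`|a| - v')^-1.
Proof.
move=> uv va v'a.
have h (s t : R) : `|s| <= t -> t < `|a| ->
  [/\ 0 < `|a| - t, `|a| - t <= `|a + s| & a + s != 0].
  move=> st ta; have p : 0 < `|a| - t by rewrite subr_gt0.
  have q : `|a| - t <= `|a + s|.
    rewrite lerBlDr -[X in `|X| <= _](addrK s) (le_trans (ler_normB _ _)) //.
    by rewrite lerD2l.
  by split=> //; rewrite -normr_gt0 (lt_le_trans p).
have [p1 q1 n1] := h _ _ (proj1 uv) va.
have [p2 q2 n2] := h _ _ (majorized_norm uv) v'a.
split; first by rewrite normfV lef_pV2 ?posrE // normr_gt0.
have -> : (a + u')^-1 - (a + u)^-1 = - (u' - u) * ((a + u')^-1 * (a + u)^-1).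
  by field; rewrite n1 n2.
have -> : (`|a| - v')^-1 - (`|a| - v)^-1 =
    (v' - v) * ((`|a| - v')^-1 * (`|a| - v)^-1).
  by field; rewrite !gt_eqF.
rewrite normrM normrN ler_pM ?(proj2 uv) // normrM !normfV.
by rewrite ler_pM ?invr_ge0 // lef_pV2 ?posrE // normr_gt0.
Qed.

(** * The comparison system *)

(** For P everywhere true this is Sigma at vertex j; for P the complement of i
    it is the denominator Sigma - Lambda_ij A_ij of the messages from j to i. *)
Definition pivot (R : realType) (d : nat) (A : 'M[R]_d) (st : gabp_state R d)
    (j : 'I_d) (P : pred 'I_d) : R :=
  A j j + \sum_(k | (k != j) && P k) gabp_Lambda st k j * A k j.

(** The right-hand side that goes with [pivot]: m, or m - m_ij. *)
Definition load (R : realType) (d : nat) (b : 'cV[R]_d) (st : gabp_state R d)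
    (j : 'I_d) (P : pred 'I_d) : R :=
  b j 0 + \sum_(k | (k != j) && P k) gabp_msg st k j.

(** The visit of vertex j without its guard against division by zero, and with
    sums over all vertices k != j.  See [gabp_visitE]. *)
Definition update (R : realType) (d : nat) (A : 'M[R]_d) (b : 'cV[R]_d)
    (st : gabp_state R d) (j : 'I_d) : gabp_state R d :=
  GabpState
    (\col_k (if k == j then load b st j predT / pivot A st j predT
             else gabp_x st k 0))
    (\matrix_(k, i) (if (k == j) && gabp_edge A j i
                     then - A i j / pivot A st j (predC1 i)
                     else gabp_Lambda st k i))
    (\matrix_(k, i) (if (k == j) && gabp_edge A j i
                     then - A i j / pivot A st j (predC1 i) *
                          load b st j (predC1 i)
                     else gabp_msg st k i)).

Definition comparison_mx (R : realType) (d : nat) (A : 'M[R]_d) : 'M[R]_d :=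
  \matrix_(i, j) (if i == j then `|A i j| else - `|A i j|).

Lemma gabp_edge_comparison (R : realType) (d : nat) (A : 'M[R]_d) j i :
  gabp_edge (comparison_mx A) j i = gabp_edge A j i.
Proof.
rewrite /gabp_edge mxE; case: eqP => //= _.
by rewrite oppr_eq0 normr_eq0.
Qed.

Lemma pivot_comparison (R : realType) (d : nat) (A : 'M[R]_d) st j P :
  pivot (comparison_mx A) st j P =
  `|A j j| - \sum_(k | (k != j) && P k) gabp_Lambda st k j * `|A k j|.
Proof.
rewrite /pivot mxE eqxx -sumrN; congr (_ + _); apply: eq_bigr => k /andP[kj _].
by rewrite mxE (negPf kj) mulrN.
Qed.

(** The weights w solve the comparison system with right-hand side c, which is
    positive and at least |b|. *)
Definition dominance (R : realType) (d : nat) (A : 'M[R]_d) (b c : 'cV[R]_d)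
    (w : 'I_d -> R) : Prop :=
  [/\ forall j, 0 < w j, forall j, 0 < c j 0, forall j, `|b j 0| <= c j 0 &
      forall j, `|A j j| * w j = c j 0 + \sum_(k | k != j) `|A j k| * w k].

(** The bounds kept by the comparison run.  The third one says that w is a
    supersolution of the branch behind the edge from k to j: the messages encode
    that, given x_j, this branch contributes m_kj + Lambda_kj |A_kj| x_j to
    row j, and at x_j = w_j this is at most the contribution |A_jk| w_k of w.
    The last one bounds Lambda_kj also when A_kj = 0. *)
Definition admissible (R : realType) (d : nat) (A : 'M[R]_d) (c : 'cV[R]_d)
    (w : 'I_d -> R) (h : gabp_state R d) : Prop :=
  (forall k, gabp_x h k 0 <= w k) /\
  forall k j, [/\ 0 <= gabp_Lambda h k j, 0 <= gabp_msg h k j,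
    gabp_msg h k j + gabp_Lambda h k j * `|A k j| * w j <= `|A j k| * w k &
    gabp_Lambda h k j * c k 0 <= `|A j k| * w k].

Lemma admissible_load_ge (R : realType) (d : nat) (A : 'M[R]_d)
    (c : 'cV[R]_d) w h j P :
  admissible A c w h -> c j 0 <= load c h j P.
Proof.
move=> [_ h_adm]; rewrite /load lerDl sumr_ge0 // => k _.
by have [] := h_adm k j.
Qed.

(** Subtract the supersolution bounds of the neighbours in P from the dominance
    equation of row j; the other neighbours keep their terms |A_jk| w_k. *)
Lemma admissible_pivot_ge (R : realType) (d : nat) (A : 'M[R]_d)
    (b c : 'cV[R]_d) w h j P :
  dominance A b c w -> admissible A c w h ->
  load c h j P + \sum_(k | (k != j) && ~~ P k) `|A j k| * w k <=
  pivot (comparison_mx A) h j P * w j.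
Proof.
move=> [w_gt0 _ _ dom] [_ h_adm]; rewrite pivot_comparison mulrBl dom.
rewrite [\sum_(k | k != j) _](bigID P) /= /load.
suff : \sum_(k | (k != j) && P k) gabp_msg h k j +
    (\sum_(k | (k != j) && P k) gabp_Lambda h k j * `|A k j|) * w j <=
    \sum_(k | (k != j) && P k) `|A j k| * w k by lra.
rewrite mulr_suml -big_split /=; apply: ler_sum => k _.
by have [] := h_adm k j.
Qed.

Lemma admissible_pivot_gt0 (R : realType) (d : nat) (A : 'M[R]_d)
    (b c : 'cV[R]_d) w h j P :
  dominance A b c w -> admissible A c w h ->
  c j 0 <= pivot (comparison_mx A) h j P * w j /\
  0 < pivot (comparison_mx A) h j P.
Proof.
move=> dom h_adm; have [w_gt0 c_gt0 _ _] := dom.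
have le_c : c j 0 <= pivot (comparison_mx A) h j P * w j.
  apply: le_trans (admissible_pivot_ge _ _ dom h_adm).
  rewrite (le_trans (admissible_load_ge j P h_adm)) // lerDl sumr_ge0 // => k _.
  by rewrite mulr_ge0 // ltW.
by split=> //; rewrite -(pmulr_lgt0 _ (w_gt0 j)) (lt_le_trans (c_gt0 j)).
Qed.

Lemma admissible_init (R : realType) (d : nat) (A : 'M[R]_d)
    (b c : 'cV[R]_d) w :
  dominance A b c w -> admissible A c w (gabp_init R d).
Proof.
move=> [w_gt0 c_gt0 _ _]; split=> [k|k j]; first by rewrite mxE ltW.
by rewrite !mxE !mul0r addr0 lexx mulr_ge0 // ltW.
Qed.

(** For the new message from j to i, the bound of [admissible_pivot_ge] that
    excludes i reads load_j + |A_ji| w_i <= pivot_j * w_j; multiplied by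
    Lambda_ji = |A_ij| / pivot_j it is the supersolution bound for (j, i). *)
Lemma admissible_update (R : realType) (d : nat) (A : 'M[R]_d)
    (b c : 'cV[R]_d) w h j :
  dominance A b c w -> admissible A c w h ->
  admissible A c w (update (comparison_mx A) c h j).
Proof.
move=> dom h_adm; have [w_gt0 c_gt0 _ _] := dom.
have [x_le h_le] := h_adm.
split=> [k|k i]; rewrite !mxE.
  case: eqP => // ->; have [_ p_gt0] := admissible_pivot_gt0 j predT dom h_adm.
  rewrite ler_pdivrMr // mulrC.
  apply: le_trans (admissible_pivot_ge _ _ dom h_adm).
  by rewrite lerDl sumr_ge0 // => l _; rewrite mulr_ge0 // ltW.
case: ifP => [/andP[/eqP-> ji] | _]; last exact: h_le.
move: ji; rewrite gabp_edge_comparison => /andP[ij _].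
rewrite (negPf ij) opprK.
set p := pivot _ _ _ _; set m := load _ _ _ _.
have [c_le p_gt0] := admissible_pivot_gt0 j (predC1 i) dom h_adm.
have m_gt0 : 0 < m.
  exact: lt_le_trans (c_gt0 j) (admissible_load_ge _ _ h_adm).
have pw : m + `|A j i| * w i <= p * w j.
  apply: le_trans (admissible_pivot_ge j (predC1 i) dom h_adm).
  rewrite lerD2l (bigD1 i) /= ?negbK ?eqxx ?andbT ?lerDl //.
  by rewrite sumr_ge0 // => l _; rewrite mulr_ge0 // ltW.
have Lp q : q <= p * w j -> `|A i j| / p * q <= `|A i j| * w j.
  by move=> qp; rewrite -mulrA ler_wpM2l // mulrC ler_pdivrMr // mulrC.
split; last exact: Lp.
- by rewrite divr_ge0 // ltW.
- by rewrite mulr_ge0 ?divr_ge0 // ltW.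
- by rewrite -[_ * `|A j i| * _]mulrA -mulrDr; exact: Lp.
Qed.

(** * Domination of the run by the comparison run *)

Definition state_majorized (R : realType) (d : nat)
    (st st' h h' : gabp_state R d) : Prop :=
  [/\ forall k, majorized (gabp_x st k 0) (gabp_x st' k 0)
                          (gabp_x h k 0) (gabp_x h' k 0),
      forall k i, majorized (gabp_Lambda st k i) (gabp_Lambda st' k i)
                            (gabp_Lambda h k i) (gabp_Lambda h' k i) &
      forall k i, majorized (gabp_msg st k i) (gabp_msg st' k i)
                            (gabp_msg h k i) (gabp_msg h' k i)].

Lemma majorized_pivotV (R : realType) (d : nat) (A : 'M[R]_d)
    (b c : 'cV[R]_d) w st st' h h' j P :
  dominance A b c w -> admissible A c w h -> admissible A c w h' ->
  state_majorized st st' h h' ->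
  majorized (pivot A st j P)^-1 (pivot A st' j P)^-1
    (pivot (comparison_mx A) h j P)^-1 (pivot (comparison_mx A) h' j P)^-1.
Proof.
move=> dom h_adm h'_adm [_ mL _].
have [_ p_gt0] := admissible_pivot_gt0 j P dom h_adm.
have [_ p'_gt0] := admissible_pivot_gt0 j P dom h'_adm.
rewrite !pivot_comparison in p_gt0 p'_gt0 *.
apply: majorized_inv; [| by rewrite -subr_gt0 | by rewrite -subr_gt0].
by apply: majorized_sum => k _; apply: majorizedM => //; exact: majorized_refl.
Qed.

Lemma majorized_load (R : realType) (d : nat) (A : 'M[R]_d)
    (b c : 'cV[R]_d) w st st' h h' j P :
  dominance A b c w -> state_majorized st st' h h' ->
  majorized (load b st j P) (load b st' j P) (load c h j P) (load c h' j P).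
Proof.
move=> [_ _ bc _] [_ _ mmu]; apply: majorizedD; first exact: majorized_refl.
by apply: majorized_sum => k _.
Qed.

(** The update formulas only use operations that preserve [majorized]. *)
Lemma update_majorized (R : realType) (d : nat) (A : 'M[R]_d)
    (b c : 'cV[R]_d) w st st' h h' j :
  dominance A b c w -> admissible A c w h -> admissible A c w h' ->
  state_majorized st st' h h' ->
  state_majorized (update A b st j) (update A b st' j)
    (update (comparison_mx A) c h j) (update (comparison_mx A) c h' j).
Proof.
move=> dom h_adm h'_adm maj; have [mx mL mmu] := maj.
have mL' i : gabp_edge A j i ->
    majorized (- A i j / pivot A st j (predC1 i))
      (- A i j / pivot A st' j (predC1 i))
      (- comparison_mx A i j / pivot (comparison_mx A) h j (predC1 i))
      (- comparison_mx A i j / pivot (comparison_mx A) h' j (predC1 i)).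
  move=> /andP[ij _]; apply: majorizedM; last first.
    exact: (majorized_pivotV _ _ dom h_adm h'_adm maj).
  by apply: majorized_refl; rewrite mxE (negPf ij) opprK normrN.
split=> [k|k i|k i]; rewrite !mxE ?gabp_edge_comparison.
- case: eqP => // _; apply: majorizedM.
    exact: (majorized_load _ _ dom maj).
  exact: (majorized_pivotV _ _ dom h_adm h'_adm maj).
- by case: ifP => // /andP[_ ji]; have := mL' _ ji; rewrite !mxE.
- case: ifP => // /andP[_ ji].
  apply: majorizedM; last exact: (majorized_load _ _ dom maj).
  by have := mL' _ ji; rewrite !mxE.
Qed.

(** Visiting any vertex, not only the next one of the schedule, changes the
    state for A at most as much as it increases the comparison state.
    Quantifying over all vertices is what makes the property inductive. *)
Definition run_invariant (R : realType) (d : nat) (A : 'M[R]_d)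
    (b c : 'cV[R]_d) w (st h : gabp_state R d) : Prop :=
  admissible A c w h /\
  forall j, state_majorized st (update A b st j)
                            h (update (comparison_mx A) c h j).

Lemma run_invariant_init (R : realType) (d : nat) (A : 'M[R]_d)
    (b c : 'cV[R]_d) w :
  dominance A b c w ->
  run_invariant A b c w (gabp_init R d) (gabp_init R d).
Proof.
move=> dom; have adm0 := admissible_init dom; split=> // j.
have maj0 : state_majorized (gabp_init R d) (gabp_init R d)
    (gabp_init R d) (gabp_init R d).
  by split=> *; apply: majorized_refl; rewrite /= !mxE normr0.
have [mx mL mmu] := update_majorized j dom adm0 adm0 maj0.
have maj_from0 (u v : R) : `|u| <= v -> majorized 0 u 0 v.
  by move=> uv; split; rewrite ?normr0 // !subr0.
have init0 : [/\ forall k, gabp_x (gabp_init R d) k 0 = 0,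
    forall k i, gabp_Lambda (gabp_init R d) k i = 0 &
    forall k i, gabp_msg (gabp_init R d) k i = 0].
  by split=> *; rewrite mxE.
case: init0 => x0 L0 mu0.
split=> [k|k i|k i]; rewrite ?x0 ?L0 ?mu0; apply: maj_from0.
- by case: (mx k).
- by case: (mL k i).
- by case: (mmu k i).
Qed.

Lemma update_other (R : realType) (d : nat) (A : 'M[R]_d) b st j k :
  k != j ->
  [/\ gabp_x (update A b st j) k 0 = gabp_x st k 0,
      forall i, gabp_Lambda (update A b st j) k i = gabp_Lambda st k i &
      forall i, gabp_msg (update A b st j) k i = gabp_msg st k i].
Proof. by move=> kj; split=> [|i|i]; rewrite mxE (negPf kj). Qed.

(** After the visit of i, compare with a further visit of j.  If j = i, this is
    the image under the visit of i of the step that the visit of i made.  If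
    j != i, only row j changes again, and its step is the visit of j in the old
    state followed by the effect on row j of the visit of i. *)
Lemma run_invariant_update (R : realType) (d : nat) (A : 'M[R]_d)
    (b c : 'cV[R]_d) w st h i :
  dominance A b c w -> run_invariant A b c w st h ->
  run_invariant A b c w (update A b st i) (update (comparison_mx A) c h i).
Proof.
move=> dom [h_adm inv]; have h1_adm := admissible_update i dom h_adm.
split=> // j; have maj := inv i.
have maj' := update_majorized j dom h_adm h1_adm maj.
have [ji|ji] := eqVneq j i; first by rewrite ji in maj' *.
have [mx mL mmu] := maj; have [mx' mL' mmu'] := maj'.
have [nx nL nmu] := inv j.
have row_j := update_other A b st ji.
have hrow_j := update_other (comparison_mx A) c h ji.
set st1 := update A b st i in mx mL mmu mx' mL' mmu' row_j *.
set h1 := update _ c h i in mx mL mmu mx' mL' mmu' hrow_j *.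
have [xj Lj muj] := row_j; have [hxj hLj hmuj] := hrow_j.
split=> [k|k l|k l]; have [->|kj] := eqVneq k j.
- by rewrite xj hxj; exact: majorized_trans (nx j) (mx' j).
- have [-> _ _] := update_other A b st1 kj.
  have [-> _ _] := update_other (comparison_mx A) c h1 kj.
  exact/majorized_refl/(majorized_norm (mx k)).
- by rewrite Lj hLj; exact: majorized_trans (nL j l) (mL' j l).
- have [_ -> _] := update_other A b st1 kj.
  have [_ -> _] := update_other (comparison_mx A) c h1 kj.
  exact/majorized_refl/(majorized_norm (mL k l)).
- by rewrite muj hmuj; exact: majorized_trans (nmu j l) (mmu' j l).
- have [_ _ ->] := update_other A b st1 kj.
  have [_ _ ->] := update_other (comparison_mx A) c h1 kj.
  exact/majorized_refl/(majorized_norm (mmu k l)).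
Qed.

(** * Runs without division by zero *)

Lemma run_invariant_norm (R : realType) (d : nat) (A : 'M[R]_d)
    (b c : 'cV[R]_d) w st h :
  run_invariant A b c w st h ->
  (forall k i, `|gabp_Lambda st k i| <= gabp_Lambda h k i) /\
  (forall k i, `|gabp_msg st k i| <= gabp_msg h k i).
Proof.
by move=> [_ inv]; split=> k i; have [_ mL mmu] := inv k;
  [case: (mL k i) | case: (mmu k i)].
Qed.

Lemma run_invariant_pivot_ge (R : realType) (d : nat) (A : 'M[R]_d)
    (b c : 'cV[R]_d) w st h j P :
  dominance A b c w -> run_invariant A b c w st h ->
  c j 0 <= `|pivot A st j P| * w j.
Proof.
move=> dom inv; have [w_gt0 _ _ _] := dom.
have [le_c _] := admissible_pivot_gt0 j P dom (proj1 inv).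
apply: le_trans le_c _; rewrite ler_pM2r // pivot_comparison lerBlDr.
rewrite -[A j j](addrK (\sum_(k | (k != j) && P k) gabp_Lambda st k j * A k j)).
rewrite (le_trans (ler_normB _ _)) // lerD2l (le_trans (ler_norm_sum _ _ _)) //.
apply: ler_sum => k _; rewrite normrM ler_wpM2r //.
by have [] := run_invariant_norm inv.
Qed.

Lemma run_invariant_pivot_neq0 (R : realType) (d : nat) (A : 'M[R]_d)
    (b c : 'cV[R]_d) w st h j P :
  dominance A b c w -> run_invariant A b c w st h -> pivot A st j P != 0.
Proof.
move=> dom inv; have [_ c_gt0 _ _] := dom.
have := run_invariant_pivot_ge j P dom inv.
by apply: contraTneq => ->; rewrite normr0 mul0r -ltNge.
Qed.

(** When A_jk = 0 the supersolution bound is 0, so the comparison messages from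
    k to j, and with them those for A, contribute nothing. *)
Lemma run_invariant_nonedge (R : realType) (d : nat) (A : 'M[R]_d)
    (b c : 'cV[R]_d) w st h k j :
  dominance A b c w -> run_invariant A b c w st h -> A j k = 0 ->
  gabp_Lambda st k j * A k j = 0 /\ gabp_msg st k j = 0.
Proof.
move=> [w_gt0 _ _ _] inv Ajk; have [nL nmu] := run_invariant_norm inv.
have [[_ h_adm] _] := inv; have [L_ge0 mu_ge0 le0 _] := h_adm k j.
rewrite Ajk normr0 mul0r in le0.
have LA_ge0 : 0 <= gabp_Lambda h k j * `|A k j| by rewrite mulr_ge0.
have LAw_ge0 := mulr_ge0 LA_ge0 (ltW (w_gt0 j)).
split; apply/eqP; rewrite -normr_le0; last first.
  by apply: le_trans (nmu k j) _; lra.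
rewrite normrM (@le_trans _ _ (gabp_Lambda h k j * `|A k j|)) ?ler_wpM2r //.
by rewrite -(pmulr_lle0 _ (w_gt0 j)); lra.
Qed.

Lemma sum_edges (R : realType) (d : nat) (A : 'M[R]_d) j (F : 'I_d -> R) :
  (forall k, A j k = 0 -> F k = 0) ->
  \sum_(k | gabp_edge A k j) F k = \sum_(k | (k != j) && predT k) F k.
Proof.
move=> F0; rewrite [RHS](bigID (fun k => A j k != 0)) /= [X in _ + X]big1.
  rewrite addr0; apply: eq_bigl => k.
  by rewrite /gabp_edge eq_sym andbT.
by move=> k /andP[_ /negPn/eqP /F0].
Qed.

Lemma pivotD1 (R : realType) (d : nat) (A : 'M[R]_d) st j i : i != j ->
  pivot A st j predT = pivot A st j (predC1 i) + gabp_Lambda st i j * A i j.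
Proof.
move=> ij; rewrite /pivot (bigD1 i) /= ?ij // -addrA; congr (_ + _).
by rewrite addrC; congr (_ + _); apply: eq_bigl => k; rewrite andbT.
Qed.

Lemma loadD1 (R : realType) (d : nat) (b : 'cV[R]_d) st j i : i != j ->
  load b st j predT = load b st j (predC1 i) + gabp_msg st i j.
Proof.
move=> ij; rewrite /load (bigD1 i) /= ?ij // -addrA; congr (_ + _).
by rewrite addrC; congr (_ + _); apply: eq_bigl => k; rewrite andbT.
Qed.

Lemma gabp_visitE (R : realType) (d : nat) (A : 'M[R]_d)
    (b c : 'cV[R]_d) w st h j :
  dominance A b c w -> run_invariant A b c w st h ->
  gabp_visit A b st j = Some (update A b st j).
Proof.
move=> dom inv.
have loadE : b j 0 + \sum_(k | gabp_edge A k j) gabp_msg st k j =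
    load b st j predT.
  congr (_ + _); apply: sum_edges => k Ajk.
  by have [] := run_invariant_nonedge dom inv Ajk.
have pivotE : A j j + \sum_(k | gabp_edge A k j) gabp_Lambda st k j * A k j =
    pivot A st j predT.
  congr (_ + _); apply: sum_edges => k Ajk.
  by have [] := run_invariant_nonedge dom inv Ajk.
have denE i : gabp_edge A j i ->
    pivot A st j predT - gabp_Lambda st i j * A i j = pivot A st j (predC1 i).
  by move=> /andP[ij _]; rewrite (pivotD1 _ _ ij) addrK.
have msgE i : gabp_edge A j i ->
    load b st j predT - gabp_msg st i j = load b st j (predC1 i).
  by move=> /andP[ij _]; rewrite (loadD1 _ _ ij) addrK.
have p_neq0 P := run_invariant_pivot_neq0 j P dom inv.
rewrite /update; case: st inv loadE pivotE denE msgE p_neq0 => x L mu /=.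
move=> inv loadE pivotE denE msgE p_neq0; rewrite loadE pivotE p_neq0 /=.
have -> : [forall i, gabp_edge A j i ==>
    (pivot A (GabpState x L mu) j predT - L i j * A i j != 0)].
  by apply/forallP => i; apply/implyP => ji; rewrite denE.
congr (Some (GabpState _ _ _)).
  apply/matrixP => k i; rewrite !mxE; case: ifP => // /andP[_ ji].
  by rewrite denE.
by apply/matrixP => k i; rewrite !mxE; case: ifP => // /andP[_ ji];
  rewrite denE ?msgE.
Qed.

(** Single visits along an arbitrary schedule sigma, so that the convergence
    proof can work visit by visit instead of sweep by sweep. *)
Fixpoint run (R : realType) (d : nat) (A : 'M[R]_d) (b : 'cV[R]_d)
    (sigma : nat -> 'I_d) (t : nat) : gabp_state R d :=
  if t is t'.+1 then update A b (run A b sigma t') (sigma t')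
  else gabp_init R d.

Lemma run_invariant_run (R : realType) (d : nat) (A : 'M[R]_d)
    (b c : 'cV[R]_d) w sigma t :
  dominance A b c w ->
  run_invariant A b c w (run A b sigma t) (run (comparison_mx A) c sigma t).
Proof.
move=> dom; elim: t => [|t ih] /=; first exact: run_invariant_init.
exact: run_invariant_update.
Qed.

Lemma gabp_sweep_run (R : realType) (d : nat) (A : 'M[R]_d)
    (b c : 'cV[R]_d) w sigma (i0 : 'I_d) s t :
  dominance A b c w ->
  (forall p, (p < size s)%N -> sigma (t + p)%N = nth i0 s p) ->
  gabp_sweep A b s (run A b sigma t) = Some (run A b sigma (t + size s)%N).
Proof.
move=> dom; rewrite /gabp_sweep.
elim: s t => [|j s ih] t sigmaE /=; first by rewrite addn0.
have inv := run_invariant_run sigma t dom.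
rewrite (gabp_visitE j dom inv).
have -> : update A b (run A b sigma t) j = run A b sigma t.+1.
  by rewrite /= -[t in sigma t]addn0 sigmaE.
rewrite ih ?addSnnS // => p ps; rewrite addSnnS.
exact: sigmaE p.+1 ps.
Qed.

Lemma gabp_run (R : realType) (d : nat) (A : 'M[R]_d)
    (b c : 'cV[R]_d) w (i0 : 'I_d) (order : seq 'I_d) n :
  dominance A b c w ->
  gabp A b order n =
  Some (run A b (fun t => nth i0 order (t %% size order)%N) (n * size order)%N).
Proof.
move=> dom; elim: n => [|n ih]; first by rewrite mul0n.
rewrite /gabp iterS -/(gabp A b order n) ih /= (gabp_sweep_run (i0 := i0) dom).
  by rewrite addnC -mulSn.
by move=> p ps; rewrite modnMDl modn_small.
Qed.

(** * Sequences *)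

(** Both v and u + v are nondecreasing and bounded, and u = (u + v) - v. *)
Lemma majorized_cvgn (R : realType) (u v : nat -> R) (C : R) :
  (forall n, majorized (u n) (u n.+1) (v n) (v n.+1)) ->
  (forall n, v n <= C) -> cvgn u.
Proof.
move=> maj vC.
have v_cvg : cvgn v.
  apply: nondecreasing_is_cvgn.
    by apply/nondecreasing_seqP => n; exact: majorized_le (maj n).
  by exists C => _ [n _ <-].
have uv_cvg : cvgn (u \+ v).
  apply: nondecreasing_is_cvgn.
    apply/nondecreasing_seqP => n /=; have [_ /ler_normlP[h _]] := maj n.
    by lra.
  exists (C + C) => _ [n _ <-] /=; have [/ler_normlP[_ h] _] := maj n.
  by rewrite lerD // (le_trans h).
have -> : u = (u \+ v) \- v by apply/funext => n /=; rewrite addrK.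
exact: is_cvgB.
Qed.

Lemma cvgn_eq_infinitely_often (R : realType) (u : nat -> R) (l c : R) :
  u @ \oo --> l -> (forall N, exists2 t, (N <= t)%N & u t = c) -> l = c.
Proof.
move=> u_l u_c; apply/eqP; rewrite -subr_eq0; apply/negPn/negP => lc.
have : (u x - c) @[x --> \oo] --> l - c by apply: cvgB => //; exact: cvg_cst.
move=> /cvgr_neq0 /(_ lc) [N _ uN]; have [t Nt ut] := u_c N.
by have := uN t Nt; rewrite /= ut subrr eqxx.
Qed.

Lemma cvg_mx_entries (R : realType) (m n : nat) (M : nat -> 'M[R]_(m, n))
    (L : 'M[R]_(m, n)) :
  (forall i j, M t i j @[t --> \oo] --> L i j) -> M @ \oo --> L.
Proof.
move=> ML A [P LP sPA].
suff : \forall t \near \oo, forall i j, P i j (M t i j).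
  by apply: filterS => t Pt; apply: sPA.
apply: filter_forall => i; apply: filter_forall => j.
exact: ML (LP i j).
Qed.

Lemma pivot_cvg (R : realType) (d : nat) (A : 'M[R]_d)
    (st : nat -> gabp_state R d) (l : gabp_state R d) j P :
  (forall k i, gabp_Lambda (st t) k i @[t --> \oo] --> gabp_Lambda l k i) ->
  pivot A (st t) j P @[t --> \oo] --> pivot A l j P.
Proof.
move=> cL; apply: cvgD; first exact: cvg_cst.
apply: cvg_big; first exact: add_continuous.
by move=> k _; apply: cvgM; [exact: cL | exact: cvg_cst].
Qed.

Lemma load_cvg (R : realType) (d : nat) (b : 'cV[R]_d)
    (st : nat -> gabp_state R d) (l : gabp_state R d) j P :
  (forall k i, gabp_msg (st t) k i @[t --> \oo] --> gabp_msg l k i) ->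
  load b (st t) j P @[t --> \oo] --> load b l j P.
Proof.
move=> cL; apply: cvgD; first exact: cvg_cst.
by apply: cvg_big; first exact: add_continuous.
Qed.

(** * Stationary states *)

(** No visit divides by zero or changes the state.  Divisions are cleared, so
    that the equations pass to limits. *)
Definition stationary (R : realType) (d : nat) (A : 'M[R]_d)
    (b : 'cV[R]_d) (st : gabp_state R d) : Prop :=
  forall j,
  [/\ forall P, pivot A st j P != 0,
      gabp_x st j 0 * pivot A st j predT = load b st j predT,
      forall i, A j i = 0 ->
        gabp_Lambda st i j * A i j = 0 /\ gabp_msg st i j = 0 &
      forall i, gabp_edge A j i ->
        gabp_Lambda st j i * pivot A st j (predC1 i) = - A i j /\
        gabp_msg st j i = gabp_Lambda st j i * load b st j (predC1 i)].

(** E_ji is the defect in the expected identity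
    m_ji - Lambda_ji A_ji x_i = - A_ij x_j, which says that the messages from j
    to i contribute to row i exactly what x_j does. *)
Lemma stationary_solution (R : realType) (d : nat) (A : 'M[R]_d)
    (b : 'cV[R]_d) (st : gabp_state R d) :
  stationary A b st -> A *m gabp_x st = b.
Proof.
move=> st_stat.
pose x j := gabp_x st j 0.
pose L := gabp_Lambda st.
pose mu := gabp_msg st.
pose E j i := mu j i - L j i * A j i * x i + A i j * x j.
have E_nonedge i j : A i j = 0 -> E j i = 0.
  move=> Aij; have [_ _ /(_ _ Aij) [LA0 mu0] _] := st_stat i.
  by rewrite /E /L /mu LA0 mu0 Aij !mul0r subrr addr0.
have E_edge i j : gabp_edge A j i -> E j i = - L j i * E i j.
  move=> ji; have [_ xE _ /(_ _ ji) [LE muE]] := st_stat j.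
  have /andP[ij _] := ji.
  rewrite /E /mu muE -/L; move: xE LE; rewrite (pivotD1 _ _ ij) (loadD1 _ _ ij).
  rewrite -/(x j) -/(L j i) -/(L i j) -/(mu i j).
  move: (pivot _ _ _ _) (load _ _ _ _) => p m xE LE.
  have -> : m = x j * (p + L i j * A i j) - mu i j by rewrite xE addrK.
  apply/subr0_eq; transitivity ((L j i * p + A i j) * x j); first by ring.
  by rewrite LE addNr mul0r.
have E0 i j : i != j -> E j i = 0.
  move=> ij; have [/E_nonedge //|Aij] := eqVneq (A i j) 0.
  have ji : gabp_edge A j i by rewrite /gabp_edge ij.
  have [Aji|Aji] := eqVneq (A j i) 0.
    by rewrite E_edge // E_nonedge // mulr0.
  have Eji := E_edge _ _ ji.
  have Eij : E i j = - L i j * E j i by rewrite E_edge // /gabp_edge eq_sym ij.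
  have [p_neq0 _ _ /(_ _ ji) [LE _]] := st_stat j.
  have := p_neq0 predT; rewrite (pivotD1 _ _ ij) => S_neq0.
  have Aij_E : A i j = - (L j i * pivot A st j (predC1 i)) by rewrite LE opprK.
  (* S_neq0 concerns the pivot of j over all neighbours, which equals
     pivot * (1 - Lambda_ji Lambda_ij) for the pivot without i. *)
  apply: (mulfI S_neq0); rewrite mulr0 Aij_E.
  transitivity (pivot A st j (predC1 i) * (E j i - L j i * L i j * E j i)).
    by rewrite -/(L i j); ring.
  by rewrite {1}Eji Eij; ring.
apply/colP => j; rewrite mxE (bigD1 j) //=.
have [_ + _ _] := st_stat j.
rewrite /pivot /load mulrDr mulrC => xE.
have -> : \sum_(k | k != j) A j k * gabp_x st k 0 =
    x j * (\sum_(k | (k != j) && predT k) L k j * A k j) -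
    \sum_(k | (k != j) && predT k) mu k j.
  rewrite mulr_sumr -sumrB; apply: eq_big => [k|k kj]; first by rewrite andbT.
  have := E0 j k; rewrite eq_sym kj => /(_ isT).
  by rewrite /E /x => E0k; apply/subr0_eq; rewrite -E0k; ring.
by rewrite addrA xE addrK.
Qed.

(** * Convergence *)

(** Each equation of [stationary] for row j holds, between consecutive states,
    at every time at which j is visited; as j is visited infinitely often and
    the states converge, it holds in the limit. *)
Lemma run_stationary_limit (R : realType) (d : nat) (A : 'M[R]_d)
    (b c : 'cV[R]_d) w sigma :
  dominance A b c w -> (forall j N, exists2 t, (N <= t)%N & sigma t = j) ->
  exists2 l, (forall k, gabp_x (run A b sigma t) k 0 @[t --> \oo] -->
                gabp_x l k 0) & stationary A b l.
Proof.
move=> dom sigma_io; have [w_gt0 c_gt0 _ _] := dom.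
pose st := run A b sigma; pose h := run (comparison_mx A) c sigma.
have inv t : run_invariant A b c w (st t) (h t) by exact: run_invariant_run.
have maj t : state_majorized (st t) (st t.+1) (h t) (h t.+1).
  by have [_] := inv t; apply.
have x_cvg k : cvgn (fun t => gabp_x (st t) k 0).
  apply: (@majorized_cvgn _ _ (fun t => gabp_x (h t) k 0) (w k)) => t.
    by have [] := maj t.
  by have [[]] := inv t.
have L_cvg k i : cvgn (fun t => gabp_Lambda (st t) k i).
  apply: (@majorized_cvgn _ _ (fun t => gabp_Lambda (h t) k i)
            (`|A i k| * w k / c k 0)) => t; first by have [] := maj t.
  by rewrite ler_pdivlMr //; have [[_ /(_ k i)[]]] := inv t.
have mu_cvg k i : cvgn (fun t => gabp_msg (st t) k i).
  apply: (@majorized_cvgn _ _ (fun t => gabp_msg (h t) k i)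
            (`|A i k| * w k)) => t; first by have [] := maj t.
  have [[_ /(_ k i)[L_ge0 _ le_w _]] _] := inv t.
  by apply: le_trans le_w; rewrite lerDl !mulr_ge0 // ltW.
pose l : gabp_state R d := GabpState
  (\col_k limn (fun t => gabp_x (st t) k 0))
  (\matrix_(k, i) limn (fun t => gabp_Lambda (st t) k i))
  (\matrix_(k, i) limn (fun t => gabp_msg (st t) k i)).
have xl k : gabp_x (st t) k 0 @[t --> \oo] --> gabp_x l k 0.
  by rewrite mxE; exact: x_cvg.
have Ll k i : gabp_Lambda (st t) k i @[t --> \oo] --> gabp_Lambda l k i.
  by rewrite mxE; exact: L_cvg.
have mul k i : gabp_msg (st t) k i @[t --> \oo] --> gabp_msg l k i.
  by rewrite mxE; exact: mu_cvg.
have pl j P : pivot A (st t) j P @[t --> \oo] --> pivot A l j P.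
  exact: pivot_cvg.
have ml j P : load b (st t) j P @[t --> \oo] --> load b l j P.
  exact: load_cvg.
have shift (u : nat -> R) (a : R) : u t @[t --> \oo] --> a ->
    u t.+1 @[t --> \oo] --> a.
  by rewrite (cvg_shiftS u).
exists l => // j; split.
- move=> P; suff : c j 0 <= `|pivot A l j P| * w j.
    by apply: contraTneq => ->; rewrite normr0 mul0r -ltNge.
  apply: (closed_cvg (F := \oo) (u_ := fun t => `|pivot A (st t) j P| * w j)
            (fun y => c j 0 <= y)).
  + exact: closed_ge.
  + by apply: nearW => t; exact: (run_invariant_pivot_ge j P dom (inv t)).
  + by apply: cvgM; [apply: cvg_norm; exact: pl | exact: cvg_cst].
- apply/subr0_eq.
  apply: (@cvgn_eq_infinitely_often _ (fun t => gabp_x (st t.+1) j 0 *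
    pivot A (st t) j predT - load b (st t) j predT)).
    apply: cvgB; last exact: ml.
    by apply: cvgM; [exact: (shift (fun t => gabp_x (st t) j 0)) | exact: pl].
  move=> N; have [t Nt tj] := sigma_io j N; exists t => //.
  rewrite /= tj mxE eqxx divfK ?subrr //.
  exact: (run_invariant_pivot_neq0 _ _ dom (inv t)).
- move=> i Aji; have nonedge t := run_invariant_nonedge dom (inv t) Aji.
  split.
    apply: (@cvgn_eq_infinitely_often _
             (fun t => gabp_Lambda (st t) i j * A i j)).
      by apply: cvgM; [exact: Ll | exact: cvg_cst].
    by move=> N; exists N => //; have [] := nonedge N.
  apply: (cvgn_eq_infinitely_often (mul i j)).
  by move=> N; exists N => //; have [] := nonedge N.
- move=> i ji; split.
    apply: (@cvgn_eq_infinitely_often _ (fun t => gabp_Lambda (st t.+1) j i *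
      pivot A (st t) j (predC1 i))).
      apply: cvgM; last exact: pl.
      exact: (shift (fun t => gabp_Lambda (st t) j i)).
    move=> N; have [t Nt tj] := sigma_io j N; exists t => //.
    rewrite /= tj mxE eqxx ji divfK //.
    exact: (run_invariant_pivot_neq0 _ _ dom (inv t)).
  apply/subr0_eq.
  apply: (@cvgn_eq_infinitely_often _ (fun t => gabp_msg (st t.+1) j i -
    gabp_Lambda (st t.+1) j i * load b (st t) j (predC1 i))).
    apply: cvgB; first exact: (shift (fun t => gabp_msg (st t) j i)).
    apply: cvgM; last exact: ml.
    exact: (shift (fun t => gabp_Lambda (st t) j i)).
  move=> N; have [t Nt tj] := sigma_io j N; exists t => //.
  by rewrite /= tj !mxE eqxx ji subrr.
Qed.

Theorem mainTheorem2 (R : realType) (d : nat) (A : 'M[R]_d)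
    (A_inv : A \in unitmx)
    (A_diag : forall i : 'I_d, A i i != 0)
    (rho_lt1 : spectral_radius (abs_scaled_offdiag A) < 1)
    (order : seq 'I_d) (order_enum : perm_eq order (enum 'I_d))
    (b : 'cV[R]_d) :
  gabp_converges_to A b order (invmx A *m b).
Proof.
pose c : 'cV[R]_d := \col_j (`|b j 0| + 1).
have c_gt0 j : 0 < c j 0 by rewrite mxE ltr_wpDl.
have [w w_gt0 wE] := dominance_weights A_diag rho_lt1 c_gt0.
have dom : dominance A b c w by split=> // j; rewrite mxE lerDl.
case: (pickP 'I_d) => [i0 _|no_vertex]; last first.
  (* In dimension 0 there is no vertex to build a schedule from. *)
  have order0 : order = [::].
    by case: order {order_enum} => // j order; have := no_vertex j.
  exists (fun=> 0); split=> [n|]; last first.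
    by apply: cvg_mx_entries => i; have := no_vertex i.
  by rewrite order0; elim: n => // n; rewrite /gabp /=; case: (iter _ _ _).
have size_gt0 : (0 < size order)%N.
  rewrite (perm_size order_enum) size_enum_ord.
  exact: leq_ltn_trans (ltn_ord i0).
(* n sweeps are n * size order visits along the periodic schedule sigma. *)
pose sigma t := nth i0 order (t %% size order)%N.
have sigma_io j N : exists2 t, (N <= t)%N & sigma t = j.
  have j_order : j \in order by rewrite (perm_mem order_enum) mem_enum.
  exists (N * size order + index j order)%N.
    by rewrite (leq_trans _ (leq_addr _ _)) // leq_pmulr.
  by rewrite /sigma modnMDl modn_small ?index_mem // nth_index.
have [l xl l_stat] := run_stationary_limit dom sigma_io.
exists (fun n => gabp_x (run A b sigma (n * size order))); split=> [n|].
  by rewrite (gabp_run i0 order n dom).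
have -> : invmx A *m b = gabp_x l.
  by rewrite -(stationary_solution l_stat) mulKmx.
apply: cvg_mx_entries => i j; rewrite ord1.
apply: (cvg_comp (muln^~ (size order))
  (fun t => gabp_x (run A b sigma t) i 0) _ (xl i)).
exact: cvg_mulnr.
Qed.
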